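(* Let $q$ be a prime power, let $p_1\neq p_2$ be points of $\mathbb{P}^2(\overline{\mathbb{F}}_q)$ such that $p_i$ is a $q^{n_i}$-point for $i=1,2$, and let the line $\ell=\langle p_1,p_2\rangle$ be a $q^k$-line. Then $k\mid\operatorname{lcm}(n_1,n_2)$, and for each $i\in\{1,2\}$ either $n_i\mid k$ or $k\mid n_i$.
   Context: Let $f=\mathrm{Frob}_q$ act on $\mathbb{P}^2(\overline{\mathbb{F}}_q)$ by raising coordinates to the $q$th power, and correspondingly on lines. A point (respectively line) whose $f$-orbit has exactly $n$ elements is called a $q^n$-point (respectively $q^n$-line). For distinct points $p_1,p_2$, $\langle p_1,p_2\rangle$ is the unique line containing both. *)

(* Defs.v *)
From HB Require Import structures.
From mathcomp Require Import all_boot all_order all_algebra all_field.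

Set Implicit Arguments.
Unset Strict Implicit.
Unset Printing Implicit Defensive.

Import GRing.Theory.
Local Open Scope ring_scope.

Definition is_algebraic_closure (F : fieldType) (K : closedFieldType)
    (iota : {rmorphism F -> K}) : Prop :=
  forall x : K, algebraicOver iota x.

(* The argument iota is not used in the value; it makes K an extension of F,
   so that x |-> x ^ #|F| is a ring morphism of K. *)
Definition Frob (F : finFieldType) (K : closedFieldType)
    (iota : {rmorphism F -> K}) (x : K) : K := x ^+ #|F|.

Lemma Frob_is_zmod_morphism (F : finFieldType) (K : closedFieldType)
    (iota : {rmorphism F -> K}) : zmod_morphism (Frob iota).
Proof.
have [p p_pr pcharF] := finPcharP F.
have pcharK : p \in [pchar K] by rewrite (fmorph_pchar iota).
have qnat : [pchar K].-nat #|F|.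
  rewrite (card_pprimeChar pcharF) pnatX; apply/orP; left.
  by rewrite pnatE.
have FD x y : Frob iota (x + y) = Frob iota x + Frob iota y.
  exact: exprDn_pchar.
move=> x y; apply: (@addIr _ (Frob iota y)).
by rewrite -FD !subrK.
Qed.

Lemma Frob_is_monoid_morphism (F : finFieldType) (K : closedFieldType)
    (iota : {rmorphism F -> K}) : monoid_morphism (Frob iota).
Proof. by split=> [|x y]; rewrite /Frob ?expr1n ?exprMn. Qed.

HB.instance Definition _ (F : finFieldType) (K : closedFieldType)
    (iota : {rmorphism F -> K}) :=
  GRing.isZmodMorphism.Build K K (Frob iota) (Frob_is_zmod_morphism iota).
HB.instance Definition _ (F : finFieldType) (K : closedFieldType)
    (iota : {rmorphism F -> K}) :=
  GRing.isMonoidMorphism.Build K K (Frob iota) (Frob_is_monoid_morphism iota).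

Lemma Frob_surj (F : finFieldType) (K : closedFieldType)
    (iota : {rmorphism F -> K}) (y : K) : exists x, Frob iota x = y.
Proof.
have q_gt0 : (0 < #|F|)%N by apply/card_gt0P; exists 0.
have [x xq] := solve_monicpoly (fun i => if i is 0 then y else 0) q_gt0.
exists x; rewrite /Frob xq.
case: #|F| q_gt0 => // m _.
rewrite big_ord_recl /= expr0 mulr1 big1 ?addr0 // => i _.
by rewrite mul0r.
Qed.

(* The q-power map v |-> v^(q) on K^3 is Frob-semilinear, and the image of a
   subspace U is the subspace spanned by the image of any basis of U; see
   mem_Frob_space for the basis-free characterization. *)
Definition Frob_space (F : finFieldType) (K : closedFieldType)
    (iota : {rmorphism F -> K}) (U : {vspace 'rV[K]_3}) : {vspace 'rV[K]_3} :=
  <<[seq map_mx (Frob iota) v | v <- vbasis U]>>%VS.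

Lemma map_mx_Frob_lin (F : finFieldType) (K : closedFieldType)
    (iota : {rmorphism F -> K}) (n : nat) (k : 'I_n -> K)
    (X : 'I_n -> 'rV[K]_3) :
  map_mx (Frob iota) (\sum_i k i *: X i)
    = \sum_i Frob iota (k i) *: map_mx (Frob iota) (X i).
Proof. by rewrite raddf_sum; apply: eq_bigr => i _; exact: map_mxZ. Qed.

Lemma Frob_combination (F : finFieldType) (K : closedFieldType)
    (iota : {rmorphism F -> K}) (n : nat) (k : 'I_n -> K) :
  exists h : 'I_n -> K, forall i, Frob iota (h i) = k i.
Proof.
have [h hP] := @fin_all_exists _ _ (fun i x => Frob iota x = k i)
  (fun i => Frob_surj iota (k i)).
by exists h.
Qed.

Lemma mem_Frob_space (F : finFieldType) (K : closedFieldType)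
    (iota : {rmorphism F -> K}) (U : {vspace 'rV[K]_3}) (v : 'rV[K]_3) :
  (map_mx (Frob iota) v \in Frob_space iota U) = (v \in U).
Proof.
pose Y := [tuple of [seq map_mx (Frob iota) w | w <- vbasis U]].
have nthY i : Y`_(i : 'I_(\dim U)) = map_mx (Frob iota) (vbasis U)`_i.
  by rewrite (nth_map 0) // size_tuple.
apply/idP/idP => [vU|vU].
- have := @coord_span _ _ _ Y _ vU.
  have [h hP] := Frob_combination iota (fun i => coord Y i (map_mx (Frob iota) v)).
  under eq_bigr => i _ do rewrite nthY -hP.
  rewrite -map_mx_Frob_lin => /map_mx_inj ->.
  by apply: memv_suml => i _; apply: memvZ; apply: vbasis_mem;
     apply: mem_nth; rewrite size_tuple.
- rewrite (coord_vbasis vU) map_mx_Frob_lin.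
  apply: memv_suml => i _; apply: memvZ; apply: memv_span.
  by apply: map_f; apply: mem_nth; rewrite size_tuple.
Qed.

Lemma dim_Frob_space (F : finFieldType) (K : closedFieldType)
    (iota : {rmorphism F -> K}) (U : {vspace 'rV[K]_3}) :
  \dim (Frob_space iota U) = \dim U.
Proof.
pose Y := [tuple of [seq map_mx (Frob iota) w | w <- vbasis U]].
suff /eqP : free Y by rewrite size_tuple.
apply/freeP => k.
have [h hP] := Frob_combination iota k.
have nthY i : Y`_(i : 'I_(\dim U)) = map_mx (Frob iota) (vbasis U)`_i.
  by rewrite (nth_map 0) // size_tuple.
under eq_bigr => i _ do rewrite nthY -hP.
rewrite -map_mx_Frob_lin => /eqP; rewrite map_mx_eq0 => /eqP h0 i.
have /freeP/(_ h h0 i) hi := basis_free (vbasisP U).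
by rewrite -hP hi rmorph0.
Qed.

Lemma Frob_space_vline (F : finFieldType) (K : closedFieldType)
    (iota : {rmorphism F -> K}) (v : 'rV[K]_3) :
  Frob_space iota <[v]> = <[map_mx (Frob iota) v]>%VS.
Proof.
apply/eqP; rewrite eq_sym eqEdim dim_Frob_space !dim_vline map_mx_eq0 leqnn.
by rewrite andbT -memvE mem_Frob_space memv_line.
Qed.

Definition ppoint (K : closedFieldType) : Type :=
  {U : {vspace 'rV[K]_3} | \dim U == 1%N}.

Definition pline (K : closedFieldType) : Type :=
  {U : {vspace 'rV[K]_3} | \dim U == 2%N}.

HB.instance Definition _ (K : closedFieldType) := Choice.on (ppoint K).
HB.instance Definition _ (K : closedFieldType) := Choice.on (pline K).

Definition on_line (K : closedFieldType) (p : ppoint K) (l : pline K) : bool :=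
  (val p <= val l)%VS.

Lemma Frob_point_subproof (F : finFieldType) (K : closedFieldType)
    (iota : {rmorphism F -> K}) (p : ppoint K) :
  \dim (Frob_space iota (val p)) == 1%N.
Proof. by rewrite dim_Frob_space (valP p). Qed.

Definition Frob_point (F : finFieldType) (K : closedFieldType)
    (iota : {rmorphism F -> K}) (p : ppoint K) : ppoint K :=
  exist _ (Frob_space iota (val p)) (Frob_point_subproof iota p).

Lemma Frob_line_subproof (F : finFieldType) (K : closedFieldType)
    (iota : {rmorphism F -> K}) (l : pline K) :
  \dim (Frob_space iota (val l)) == 2%N.
Proof. by rewrite dim_Frob_space (valP l). Qed.

Definition Frob_line (F : finFieldType) (K : closedFieldType)
    (iota : {rmorphism F -> K}) (l : pline K) : pline K :=
  exist _ (Frob_space iota (val l)) (Frob_line_subproof iota l).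

Lemma on_line_Frob (F : finFieldType) (K : closedFieldType)
    (iota : {rmorphism F -> K}) (p : ppoint K) (l : pline K) :
  on_line (Frob_point iota p) (Frob_line iota l) = on_line p l.
Proof.
rewrite /on_line /=; apply/idP/idP => /subvP sUV; last first.
  apply/span_subvP => w /mapP[u uU ->].
  by rewrite mem_Frob_space sUV // vbasis_mem.
apply/subvP => v vp; rewrite -(mem_Frob_space iota); apply: sUV.
by rewrite mem_Frob_space.
Qed.

Lemma line_through_subproof (K : closedFieldType) (p1 p2 : ppoint K) :
  p1 != p2 -> \dim (val p1 + val p2)%VS == 2%N.
Proof.
move=> ne12; have [d1 d2] := (eqP (valP p1), eqP (valP p2)).
suff d0 : \dim (val p1 :&: val p2)%VS = 0%N.
  by have := dimv_sum_cap (val p1) (val p2); rewrite d0 addn0 d1 d2 => ->.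
apply/eqP; apply: contraNT ne12; rewrite -lt0n => dgt0.
have e1 : (val p1 :&: val p2)%VS == val p1 by rewrite eqEdim capvSl d1.
have e2 : (val p1 :&: val p2)%VS == val p2 by rewrite eqEdim capvSr d2.
by apply/eqP/val_inj; rewrite -(eqP e1) (eqP e2).
Qed.

Definition line_through (K : closedFieldType) (p1 p2 : ppoint K)
    (ne12 : p1 != p2) : pline K :=
  exist _ (val p1 + val p2)%VS (line_through_subproof ne12).

Lemma line_throughP (K : closedFieldType) (p1 p2 : ppoint K)
    (ne12 : p1 != p2) (l : pline K) :
  on_line p1 l && on_line p2 l = (l == line_through ne12).
Proof.
rewrite /on_line -subv_add -val_eqE /= eq_sym eqEdim.
by rewrite (eqP (valP l)) (eqP (line_through_subproof ne12)) leqnn andbT.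
Qed.

Definition orbit_has_card (T : eqType) (f : T -> T) (x : T) (n : nat) : Prop :=
  exists s : seq T,
    [/\ uniq s, size s = n & forall y, y \in s <-> exists i, y = iter i f x].

(* With q = #|F|: q^n-points and q^n-lines. *)
Definition is_qpoint (F : finFieldType) (K : closedFieldType)
    (iota : {rmorphism F -> K}) (n : nat) (p : ppoint K) : Prop :=
  orbit_has_card (Frob_point iota) p n.

Definition is_qline (F : finFieldType) (K : closedFieldType)
    (iota : {rmorphism F -> K}) (n : nat) (l : pline K) : Prop :=
  orbit_has_card (Frob_line iota) l n.

(* Main.v *)
Require Import Defs.
From HB Require Import structures.
From mathcomp Require Import all_boot all_order all_algebra all_field.

Set Implicit Arguments.
Unset Strict Implicit.
Unset Printing Implicit Defensive.

(** Frobenius is injective and preserves incidence, so a power of it that fixes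
    two distinct points of a line fixes the line.  Taking the power
    [lcmn n1 n2] gives the first claim.  If [n] does not divide [k], then the
    [k]-th image of an [n]-periodic point [p] of [l] is a second point of [l];
    the [n]-th power fixes both points, hence fixes [l], so [k] divides [n]. *)

(** Finiteness makes the iterates of [x] run into a cycle; injectivity of [f] rules out a tail
    before it, so [x] itself lies on the cycle, whose length is then [n]. *)
Lemma orbit_has_card_iter (T : eqType) (f : T -> T) (x : T) (n : nat) :
  injective f -> orbit_has_card f x n ->
  forall m, iter m f x = x <-> n %| m.
Proof.
move=> f_inj [s [s_uniq s_size sP]].
have iter_s i : iter i f x \in s by apply/sP; exists i.
(* Pigeonhole: [n.+1] distinct iterates do not fit into [s]. *)
have loop_n : looping f x n.
  apply/negPn/negP; rewrite -looping_uniq => u_traj.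
  have /(uniq_leq_size u_traj) : {subset traject f x n.+1 <= s}.
    by move=> y /trajectP[i _ ->].
  by rewrite size_traject s_size ltnn.
have traj_uniq : uniq (traject f x n).
  apply: (leq_size_uniq s_uniq); last by rewrite size_traject s_size.
  by move=> y /sP[i ->]; apply: (loopingP loop_n).
have iter_lt i : i < n -> iter i f x = x -> i = 0.
  move=> lt_in fix_i; have n_gt0 := leq_ltn_trans (leq0n i) lt_in.
  apply/eqP; rewrite -(nth_uniq x _ _ traj_uniq) ?size_traject //.
  by rewrite !nth_traject //= fix_i.
have period : iter n f x = x.
  (* Cancelling [i] steps gives a return to [x] after [n - i] steps, which [iter_lt] excludes when
     [0 < i < n]. *)
  have /trajectP[i lt_in iter_ni] := loopingP loop_n n.
  have : iter (n - i) f x = x.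
    have iter_inj : injective (iter i f) by elim: (i) => //= j IHj; apply: inj_comp.
    by apply: iter_inj; rewrite -iterD subnKC // ltnW.
  case: i lt_in iter_ni => [|i] lt_in iter_ni; first by rewrite subn0.
  move/iter_lt; rewrite ltn_subrL (leq_ltn_trans _ lt_in) //= => /(_ isT)/eqP.
  by rewrite subn_eq0 leqNgt lt_in.
have iter_mul d : iter (d * n) f x = x.
  by elim: d => // d IHd; rewrite mulSn iterD IHd.
move=> m; split=> [|/dvdnP[d ->] //].
rewrite {1}(divn_eq m n) addnC iterD iter_mul => /iter_lt.
(* The remainder is below [n] only if [n > 0], which holds because [s] contains [x]. *)
rewrite ltn_mod -s_size -has_predT => m0; apply/eqP; rewrite m0 //.
by apply/hasP; exists x => //; apply: (iter_s 0).
Qed.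

Section Frobenius.

Variables (F : finFieldType) (K : closedFieldType) (iota : {rmorphism F -> K}).

Lemma Frob_space_inj : injective (Frob_space iota).
Proof.
move=> U V eqUV; apply/vspaceP => v.
by rewrite -(mem_Frob_space iota U) eqUV mem_Frob_space.
Qed.

Lemma Frob_point_inj : injective (Frob_point iota).
Proof. by move=> p q /(congr1 val)/Frob_space_inj/val_inj. Qed.

Lemma Frob_line_inj : injective (Frob_line iota).
Proof. by move=> l m /(congr1 val)/Frob_space_inj/val_inj. Qed.

Lemma on_line_iter_Frob (m : nat) (p : ppoint K) (l : pline K) :
  on_line (iter m (Frob_point iota) p) (iter m (Frob_line iota) l)
    = on_line p l.
Proof. by elim: m => //= m IHm; rewrite on_line_Frob. Qed.

Lemma iter_Frob_line_fixed (m : nat) (p q : ppoint K) (l : pline K) :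
  p != q -> on_line p l -> on_line q l ->
  iter m (Frob_point iota) p = p -> iter m (Frob_point iota) q = q ->
  iter m (Frob_line iota) l = l.
Proof.
move=> ne_pq pl ql fix_p fix_q; apply/eqP.
have /eqP lE : l == line_through ne_pq by rewrite -line_throughP pl.
(* By uniqueness of the line through [p] and [q], it suffices that both lie on the image of [l];
   each is replaced by its own image. *)
rewrite [eqbRHS]lE -line_throughP -{1}fix_p -{1}fix_q.
by rewrite !on_line_iter_Frob pl.
Qed.

Lemma qpoint_on_qline_dvdn (n k : nat) (p : ppoint K) (l : pline K) :
  is_qpoint iota n p -> is_qline iota k l -> on_line p l ->
  n %| k \/ k %| n.
Proof.
move=> /(orbit_has_card_iter Frob_point_inj) pP.
move=> /(orbit_has_card_iter Frob_line_inj) lP pl.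
have [fix_k|ne_k] := eqVneq (iter k (Frob_point iota) p) p.
  by left; apply/pP.
right; apply/lP; have fix_n := (pP n).2 (dvdnn n).
apply: (iter_Frob_line_fixed ne_k) => //.
  (* The [k]-th image of [p] lies on the [k]-th image of [l], which is [l]. *)
  by rewrite -{1}((lP k).2 (dvdnn k)) on_line_iter_Frob.
by rewrite -iterD addnC iterD fix_n.
Qed.

End Frobenius.

Theorem lemma4p2 (Fq : finFieldType) (K : closedFieldType)
    (iota : {rmorphism Fq -> K}) (hK : is_algebraic_closure iota)
    (p1 p2 : ppoint K) (ne12 : p1 != p2) (n1 n2 k : nat)
    (hp1 : is_qpoint iota n1 p1) (hp2 : is_qpoint iota n2 p2)
    (hl : is_qline iota k (line_through ne12)) :
  k %| lcmn n1 n2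
  /\ (n1 %| k \/ k %| n1)
  /\ (n2 %| k \/ k %| n2).
Proof.
have /andP[on1 on2] :
    on_line p1 (line_through ne12) && on_line p2 (line_through ne12).
  by rewrite line_throughP.
split; last split.
2: exact: qpoint_on_qline_dvdn hp1 hl on1.
2: exact: qpoint_on_qline_dvdn hp2 hl on2.
(* Divisibility by [k] becomes the claim that the [lcmn n1 n2]-th power fixes the line. *)
apply/(orbit_has_card_iter (Frob_line_inj (iota := iota)) hl).
apply: (iter_Frob_line_fixed ne12) => //.
  by apply/(orbit_has_card_iter (Frob_point_inj (iota := iota)) hp1)/dvdn_lcml.
by apply/(orbit_has_card_iter (Frob_point_inj (iota := iota)) hp2)/dvdn_lcmr.
Qed.
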